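(* Let $a,b,n$ be positive integers with $a>b$, and define \[ \tau_0(an,bn,q)'=\sum_{k=an-bn-\lfloor n/2\rfloor}^{an-bn}(-1)^kq^{ank-\binom{k}{2}}\begin{bmatrix} an\\ k\end{bmatrix}\begin{bmatrix} 2an-2k\\ an-bn-k\end{bmatrix}. \] Then, modulo $\Phi_n(q)^2$, \[ \tau_0(an,bn,q)'\equiv(-1)^{an-bn}q^{(an-bn)(an+bn+1)/2}\begin{bmatrix} an\\ bn\end{bmatrix}\Big\{1-(a-b)\big(2-\theta_n(q)-\vartheta_n(q)\big)\Big\}, \] where \[ \theta_n(q)=\begin{cases} (-1)^m(1+q^m)q^{m(3m-1)/2}, &\text{if } n=3m,\\ (-1)^mq^{m(3m+1)/2}, &\text{if } n=3m+1,\\ (-1)^{m+1}q^{(m+1)(3m+2)/2}, &\text{if } n=3m+2,\end{cases} \qquad \vartheta_n(q)=\begin{cases} (-1)^m(1+q^{2m})q^{m(3m-5)/2}, &\text{if } n=3m,\\ (-1)^mq^{m(3m+1)/2}, &\text{if } n=3m+1,\\ (-1)^{m+1}q^{(m-1)(3m+2)/2}, &\text{if } n=3m+2.\end{cases} \]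
   Context: For integers $n,m$, the $q$-binomial coefficient is $\begin{bmatrix} n\\ m\end{bmatrix}=\frac{(1-q^n)(1-q^{n-1})\cdots(1-q^{n-m+1})}{(1-q)(1-q^2)\cdots(1-q^m)}$ if $0\le m\le n$, and $0$ otherwise; $\binom{k}{2}=k(k-1)/2$. $\Phi_n(q)$ denotes the $n$-th cyclotomic polynomial. $\lfloor x\rfloor$ is the integer part of $x$. For rational functions (including Laurent polynomials) $A(q),B(q)$, $A\equiv B\pmod{\Phi_n(q)^2}$ means $A-B=\Phi_n(q)^2P(q)/Q(q)$ with $P,Q\in\mathbb{Z}[q]$ and $Q$ coprime to $\Phi_n(q)$. *)

(* Defs.v *)
From mathcomp Require Import all_boot all_order all_algebra.
From mathcomp Require Import fraction cyclotomic.

Set Implicit Arguments.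
Unset Strict Implicit.
Unset Printing Implicit Defensive.

Import Order.TTheory GRing.Theory Num.Theory.
Local Open Scope ring_scope.

(* The field Z(q).  Its elements admit integer powers [x ^ z] with z : int,
   so Laurent polynomials live here as well. *)
Notation Zq := {fraction {poly int}}.

Definition q : Zq := tofrac ('X : {poly int}).

(* On {poly int}, [coprimep] says that the (pseudo-)gcd is a nonzero constant;
   as 'Phi_n is monic and irreducible this is coprimality in Z[q]. *)
Definition eqmod_Phi2 (n : nat) (A B : Zq) : Prop :=
  exists P Q : {poly int},
    coprimep Q 'Phi_n /\ A - B = tofrac ('Phi_n ^+ 2 * P) / tofrac Q.

Definition qbinom (n m : int) : Zq :=
  if 0 <= m <= n then
    (\prod_(0 <= i < `|m|%N) (1 - q ^ (n - i%:Z)))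
      / (\prod_(1 <= i < `|m|%N.+1) (1 - q ^ i%:Z))
  else 0.

(* tau0' a b n is tau_0(an, bn, q)'.  For 0 < n and b < a the truncated lower
   bound of the range is the true one, since an - bn >= n >= n./2. *)
Definition tau0' (a b n : nat) : Zq :=
  \sum_(a * n - b * n - n./2 <= k < (a * n - b * n).+1)
    (-1) ^+ k * q ^ ((a * n * k)%:Z - 'C(k, 2)%:Z)
      * qbinom (a * n)%:Z k%:Z
      * qbinom ((2 * a * n)%:Z - (2 * k)%:Z)
               ((a * n)%:Z - (b * n)%:Z - k%:Z).

(* In theta and vartheta all the divisions by 2 are exact; the exponents
   m(3m-5)/2 (for m = 1) and (m-1)(3m+2)/2 (for m = 0) equal -1. *)
Definition theta (n : nat) : Zq :=
  let m := (n %/ 3)%N in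
  let z := m%:Z in
  match (n %% 3)%N with
  | 0 => (-1) ^+ m * (1 + q ^ z) * q ^ (z * (3 * z - 1) %/ 2)%Z
  | 1 => (-1) ^+ m * q ^ (z * (3 * z + 1) %/ 2)%Z
  | _ => (-1) ^+ m.+1 * q ^ ((z + 1) * (3 * z + 2) %/ 2)%Z
  end.

Definition vartheta (n : nat) : Zq :=
  let m := (n %/ 3)%N in
  let z := m%:Z in
  match (n %% 3)%N with
  | 0 => (-1) ^+ m * (1 + q ^ (2 * z)) * q ^ (z * (3 * z - 5) %/ 2)%Z
  | 1 => (-1) ^+ m * q ^ (z * (3 * z + 1) %/ 2)%Z
  | _ => (-1) ^+ m.+1 * q ^ ((z - 1) * (3 * z + 2) %/ 2)%Z
  end.

(* Main.v *)
(* With K = an - bn, substitute k = K - j. The summand j = 0 is the main term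
   (-1)^K q^(...) [an, bn]; for j >= 1 the summand is the main term times
   (1 - q^K) U_j, where 1 - q^K = (1 - q^n)(1 + q^n + ... + q^(K-n)) is divisible
   by Phi_n and congruent to (a-b)(1 - q^n) modulo Phi_n^2.  Hence only the values
   of the U_j at a primitive n-th root of unity matter, and there U_j agrees with
   V_j = (-1)^j q^C(j,2) (1 + q^-j) [n-j, j] / (1 - q^(n-j)).  Finally
   1 + sum_j (-1)^j q^C(j,2) (1-q^n)/(1-q^(n-j)) [n-j, j] equals theta_n, the same
   sum with q^-j inserted equals vartheta_n, so that (1-q^n) sum_j V_j is
   theta_n + vartheta_n - 2.  Both evaluations reduce to
   F_n = sum_k (-1)^k q^C(k,2) [n-k, k]: the two Pascal rules give
   F_(n+3) = -q^(n+1) F_n, and theta_n = F_n - q^(n-1) F_(n-2),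
   vartheta_n = F_n - q^-1 F_(n-2). *)

Require Import Defs.
From mathcomp Require Import all_boot all_order all_algebra all_field.
From mathcomp Require Import fraction cyclotomic ring zify.
Import GRing.Theory.
Local Open Scope ring_scope.

Set Implicit Arguments.
Unset Strict Implicit.
Unset Printing Implicit Defensive.

(** * Cyclotomic divisibility, and values of rational functions at a root of unity *)

Notation pZtoC := (map_poly (intr : int -> algC)).

(** Since ['Phi_n] is monic, division with remainder works over the integers. The remainder vanishes
    at [z] but has smaller degree than the minimal polynomial of [z], so it is zero. *)
Lemma Cyclotomic_dvdp (n : nat) (z : algC) (P : {poly int}) :
  n.-primitive_root z -> root (pZtoC P) z -> exists R, P = 'Phi_n * R.
Proof.
move=> zP Pz.
have monP := Cyclotomic_monic n.
have := Pdiv.RingMonic.rdivp_eq monP P.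
set A := Pdiv.Ring.rdivp _ _; set B := Pdiv.Ring.rmodp _ _ => defP.
have ltB : (size B < size 'Phi_n)%N.
  by rewrite Pdiv.Ring.ltn_rmodp monic_neq0.
suff B0 : B = 0 by exists A; rewrite defP B0 addr0 mulrC.
have PhiE : pZtoC 'Phi_n = cyclotomic z n by exact: Cintr_Cyclotomic.
have Bz : root (pZtoC B) z.
  have -> : B = P - A * 'Phi_n by rewrite {1}defP addrC addKr.
  rewrite rmorphB rmorphM /= rootE !hornerE (eqP Pz) PhiE.
  have /rootP -> : root (cyclotomic z n) z by rewrite root_cyclotomic.
  by rewrite mulr0 subr0.
have [p [pE _ pP]] := minCpolyP z.
have Brat : pZtoC B = map_poly (ratr : rat -> algC) (map_poly intr B).
  by rewrite -map_poly_comp; apply: eq_map_poly => i /=; rewrite ratr_int.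
have sB : size (map_poly (intr : int -> rat) B) = size B.
  by apply: size_map_inj_poly => //; apply: intr_inj.
move: Bz; rewrite Brat pP => pB.
apply/eqP; rewrite -size_poly_eq0 -sB size_poly_eq0; apply/negP => /negP B0.
have := dvdp_leq B0 pB; rewrite sB leqNgt => /negP; apply.
apply: leq_trans ltB _.
have -> : size p = size (minCpoly z) by rewrite pE size_map_poly.
by rewrite (minCpoly_cyclotomic zP) -PhiE size_map_inj_poly //; apply: intr_inj.
Qed.

(** A nonconstant gcd has a complex root [w], which is a root of ['Phi_n] and so again a primitive
    [n]-th root of unity. Then ['Phi_n] divides [Q], which forces [Q] to vanish at [z] too. *)
Lemma coprimep_Cyclotomic (n : nat) (z : algC) (Q : {poly int}) :
  n.-primitive_root z -> ~~ root (pZtoC Q) z -> coprimep Q 'Phi_n.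
Proof.
move=> zP Qz; rewrite /coprimep.
set g := gcdp Q 'Phi_n.
have Phi0 : 'Phi_n != 0 by exact/monic_neq0/Cyclotomic_monic.
have g0 : g != 0 by rewrite gcdp_eq0 negb_and Phi0 orbT.
have [|sg] := eqVneq (size g) 1%N => //.
have [w gw] : exists w, root (pZtoC g) w.
  by apply/closed_rootP; rewrite size_map_inj_poly //; apply: intr_inj.
have rootw (p : {poly int}) : g %| p -> root (pZtoC p) w.
  (* Over the integers [%|] is pseudo-divisibility: only some multiple [c *: p] with [c] nonzero
     factors through [g], and [c] does not affect the roots. *)
  case/Pdiv.Idomain.dvdpP => -[c u] /= c0 e.
  have : root (pZtoC (c *: p)) w.
    by rewrite e rmorphM /= rootM gw orbT.
  by rewrite map_polyZ /= rootZ // intr_eq0.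
have wP : n.-primitive_root w.
  rewrite -(root_cyclotomic zP) -(Cintr_Cyclotomic zP).
  exact/rootw/Pdiv.Idomain.dvdp_gcdr.
have [R QE] := Cyclotomic_dvdp wP (rootw _ (Pdiv.Idomain.dvdp_gcdl _ _)).
case/negP: Qz; rewrite QE rmorphM /= rootM (Cintr_Cyclotomic zP).
by rewrite root_cyclotomic // zP.
Qed.

(* [ev z x c]: the rational function [x] is defined at [q = z] with value [c]. *)
Definition ev (z : algC) (x : Zq) (c : algC) : Prop :=
  exists P Q : {poly int},
    [/\ (pZtoC Q).[z] != 0, x = tofrac P / tofrac Q
      & c = (pZtoC P).[z] / (pZtoC Q).[z]].

Lemma tofrac_neq0 (z : algC) (Q : {poly int}) :
  (pZtoC Q).[z] != 0 -> tofrac Q != 0 :> Zq.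
Proof.
by move=> Qz; rewrite tofrac_eq0; apply: contraNneq Qz => ->; rewrite rmorph0 horner0.
Qed.

Lemma ev_add z x y c d : ev z x c -> ev z y d -> ev z (x + y) (c + d).
Proof.
move=> [P [Q [Q0 -> ->]]] [R [S [S0 -> ->]]].
exists (P * S + R * Q), (Q * S); split.
- by rewrite rmorphM hornerM mulf_neq0.
- rewrite (addf_div _ _ (tofrac_neq0 Q0) (tofrac_neq0 S0)) tofracD !tofracM.
  exact: erefl.
- by rewrite (addf_div _ _ Q0 S0) rmorphD !rmorphM /= hornerD !hornerM.
Qed.

Lemma ev_mul z x y c d : ev z x c -> ev z y d -> ev z (x * y) (c * d).
Proof.
move=> [P [Q [Q0 -> ->]]] [R [S [S0 -> ->]]].
exists (P * R), (Q * S); split.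
- by rewrite rmorphM hornerM mulf_neq0.
- rewrite mulf_div !tofracM; exact: erefl.
- by rewrite mulf_div !rmorphM /= !hornerM.
Qed.

Lemma ev_inv z x c : ev z x c -> c != 0 -> ev z x^-1 c^-1.
Proof.
move=> [P [Q [Q0 -> ->]]] c0; exists Q, P; rewrite !invf_div; split; [|exact: erefl|exact: erefl].
by apply: contraNneq c0 => ->; rewrite mul0r.
Qed.

Lemma ev_poly z (P : {poly int}) : ev z (tofrac P) (pZtoC P).[z].
Proof.
exists P, 1; rewrite !rmorph1 hornerC !divr1 oner_eq0.
by split; [|exact: erefl|exact: erefl].
Qed.

Lemma ev_int z (i : int) : ev z i%:~R i%:~R.
Proof.
have := ev_poly z i%:P; rewrite map_polyC hornerC.
have -> : i%:P = i%:~R :> {poly int} by rewrite -{1}[i]intz rmorph_int.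
by rewrite rmorph_int.
Qed.

Lemma ev1 z : ev z 1 1. Proof. exact: (ev_int z 1). Qed.

Lemma ev_q z : ev z q z.
Proof. by have := ev_poly z 'X; rewrite map_polyX hornerX. Qed.

Lemma ev_opp z x c : ev z x c -> ev z (- x) (- c).
Proof. by move=> h; rewrite -[- x]mulN1r -[- c]mulN1r; apply: ev_mul => //; exact: (ev_int z (-1)). Qed.

Lemma ev_sub z x y c d : ev z x c -> ev z y d -> ev z (x - y) (c - d).
Proof. by move=> hx hy; apply: ev_add => //; apply: ev_opp. Qed.

Lemma ev_exp z x c k : ev z x c -> ev z (x ^+ k) (c ^+ k).
Proof.
move=> h; elim: k => [|k IH]; first exact: ev1.
by rewrite !exprS; apply: ev_mul.
Qed.

Lemma ev_expz z x c (k : int) : ev z x c -> c != 0 -> ev z (x ^ k) (c ^ k).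
Proof.
move=> h c0; case: k => k; first exact: ev_exp.
by apply: ev_inv; [exact: ev_exp | rewrite expf_neq0].
Qed.

Lemma ev_sum z m p (f : nat -> Zq) (g : nat -> algC) :
  (forall i, (m <= i < p)%N -> ev z (f i) (g i)) ->
  ev z (\sum_(m <= i < p) f i) (\sum_(m <= i < p) g i).
Proof.
move=> h; rewrite !big_nat; elim/big_rec2: _ => [|i y1 y2 hi IH].
  exact: (ev_int z 0).
by apply: ev_add => //; apply: h.
Qed.

Lemma ev_prod z m p (f : nat -> Zq) (g : nat -> algC) :
  (forall i, (m <= i < p)%N -> ev z (f i) (g i)) ->
  ev z (\prod_(m <= i < p) f i) (\prod_(m <= i < p) g i).
Proof.
move=> h; rewrite !big_nat; elim/big_rec2: _ => [|i y1 y2 hi IH].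
  exact: ev1.
by apply: ev_mul => //; apply: h.
Qed.

(** One factor ['Phi_n] comes from [1 - q ^+ n], the other from the vanishing of [x] at [z]. The
    denominators of [x] and [y] do not vanish at [z], hence are coprime to ['Phi_n]. *)
Lemma eqmod_Phi2_ev n z (A B x y c : Zq) :
  n.-primitive_root z -> A - B = (1 - q ^+ n) * x * y ->
  ev z x 0 -> (exists d, ev z y d) -> eqmod_Phi2 n A B.
Proof.
move=> zP E [P [Q [Q0 xE c0]]] [d [R [S [S0 yE _]]]].
have Pz : root (pZtoC P) z.
  by move/esym/eqP: c0; rewrite mulf_eq0 invr_eq0 (negPf Q0) orbF.
have [P' PE] := Cyclotomic_dvdp zP Pz.
have [T TE] : exists T, 1 - 'X^n = 'Phi_n * T :> {poly int}.
  apply: (Cyclotomic_dvdp zP).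
  by rewrite rmorphB /= map_polyXn rmorph1 rootE !hornerE prim_expr_order ?subrr.
exists (T * P' * R), (Q * S); split.
  by apply: (coprimep_Cyclotomic zP); rewrite rootE rmorphM hornerM mulf_neq0.
rewrite E xE yE PE.
have -> : 1 - q ^+ n = tofrac (1 - 'X^n : {poly int}).
  by rewrite rmorphB rmorph1 rmorphXn.
rewrite TE !rmorphM /= invfM; ring.
Qed.

(** * Gaussian binomials and the alternating sums [F_n] *)

Definition qfac (F : fieldType) (x : F) n : F := \prod_(1 <= i < n.+1) (1 - x ^+ i).

Definition qb (F : fieldType) (x : F) n m : F :=
  if (m <= n)%N then qfac x n / (qfac x m * qfac x (n - m)) else 0.

(** At [y = 1] this is the [F_n] of the header. The parameter [y] is there because the Pascal rules
    rescale it by [x] or [x^-1]. *)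
Definition Fsum (F : fieldType) (x y : F) n : F :=
  \sum_(0 <= k < n./2.+1) (-1) ^+ k * y ^+ k * x ^+ 'C(k, 2) * qb x (n - k) k.

Section GaussianBinomials.

Variables (F : fieldType) (x : F).
Hypothesis x_not1 : forall i, (0 < i)%N -> 1 - x ^+ i != 0.

Lemma qfac0 : qfac x 0 = 1.
Proof. by rewrite /qfac big_geq. Qed.

Lemma qfacS n : qfac x n.+1 = qfac x n * (1 - x ^+ n.+1).
Proof. by rewrite /qfac big_nat_recr. Qed.

Lemma qfac_neq0 n : qfac x n != 0.
Proof.
by elim: n => [|n IH]; rewrite (qfac0, qfacS) ?oner_eq0 // mulf_neq0 ?x_not1.
Qed.

Lemma qb_small n m : (n < m)%N -> qb x n m = 0.
Proof. by rewrite /qb ltnNge => /negbTE ->. Qed.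

Lemma qbE m d : qb x (m + d) m = qfac x (m + d) / (qfac x m * qfac x d).
Proof. by rewrite /qb leq_addr addKn. Qed.

Lemma qb0 n : qb x n 0 = 1.
Proof. by rewrite -[n]add0n qbE qfac0 mul1r divff ?qfac_neq0. Qed.

Lemma qbn n : qb x n n = 1.
Proof. by rewrite -{1}[n]addn0 qbE qfac0 mulr1 addn0 divff ?qfac_neq0. Qed.

Lemma qb_absorb n k :
  qb x n.+1 k.+1 * (1 - x ^+ k.+1) = (1 - x ^+ n.+1) * qb x n k.
Proof.
have [nk|/subnKC <-] := ltnP n k; first by rewrite !qb_small ?mul0r ?mulr0.
rewrite -addSn !qbE addSn !qfacS.
have := (qfac_neq0 k, qfac_neq0 (n - k), x_not1 (ltn0Sn k)).
by move=> [[? ?] ?]; field; repeat (apply/andP; split).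
Qed.

Lemma qb_pascal1 n k :
  qb x n.+1 k.+1 = qb x n k.+1 + x ^+ (n - k) * qb x n k.
Proof.
have [nk|] := ltnP n k; first by rewrite !qb_small ?mulr0 ?addr0 // ltnW.
rewrite leq_eqVlt => /orP[/eqP <-|/subnKC <-].
  by rewrite !qbn qb_small // subnn mul1r add0r.
set d := (n - k.+1)%N.
rewrite qbE (_ : qb x (k.+1 + d) k = qfac x (k + d.+1) / (qfac x k * qfac x d.+1)).
  2: by rewrite addSnnS qbE.
rewrite (_ : qb x (k.+1 + d).+1 k.+1
           = qfac x (k.+1 + d.+1) / (qfac x k.+1 * qfac x d.+1)).
  2: by rewrite -addnS qbE.
have -> : (k.+1 + d - k = d.+1)%N by lia.
rewrite !addSn !addnS !qfacS.
have := (qfac_neq0 k, qfac_neq0 d, x_not1 (ltn0Sn k), x_not1 (ltn0Sn d)).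
have -> : x ^+ (k + d).+2 = x ^+ k.+1 * x ^+ d.+1 by rewrite -exprD addnS.
by move=> [[[? ?] ?] ?]; field; repeat (apply/andP; split).
Qed.

Lemma qb_pascal2 n k :
  qb x n.+1 k.+1 = x ^+ k.+1 * qb x n k.+1 + qb x n k.
Proof.
have [nk|] := ltnP n k; first by rewrite !qb_small ?mulr0 ?addr0 // ltnW.
rewrite leq_eqVlt => /orP[/eqP <-|/subnKC <-].
  by rewrite !qbn qb_small // mulr0 add0r.
set d := (n - k.+1)%N.
rewrite qbE (_ : qb x (k.+1 + d) k = qfac x (k + d.+1) / (qfac x k * qfac x d.+1)).
  2: by rewrite addSnnS qbE.
rewrite (_ : qb x (k.+1 + d).+1 k.+1
           = qfac x (k.+1 + d.+1) / (qfac x k.+1 * qfac x d.+1)).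
  2: by rewrite -addnS qbE.
rewrite !addSn !addnS !qfacS.
have := (qfac_neq0 k, qfac_neq0 d, x_not1 (ltn0Sn k), x_not1 (ltn0Sn d)).
have -> : x ^+ (k + d).+2 = x ^+ k.+1 * x ^+ d.+1 by rewrite -exprD addnS.
by move=> [[[? ?] ?] ?]; field; repeat (apply/andP; split).
Qed.

Lemma Fsum_widen y n B : (n./2 < B)%N ->
  Fsum x y n =
  \sum_(0 <= k < B) (-1) ^+ k * y ^+ k * x ^+ 'C(k, 2) * qb x (n - k) k.
Proof.
move=> nB; rewrite (big_cat_nat (leq0n _) nB) //= [X in _ + X]big_nat_cond.
rewrite [X in _ + X]big1 ?addr0 // => k /andP[/andP[nk _] _].
by rewrite qb_small ?mulr0 //; lia.
Qed.

Lemma Fsum_recl y n : Fsum x y n.+2 =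
  1 + \sum_(0 <= k < n./2.+1)
        (-1) ^+ k.+1 * y ^+ k.+1 * x ^+ 'C(k.+1, 2) * qb x (n.+1 - k) k.+1.
Proof. by rewrite /Fsum big_nat_recl //= qb0 !expr0 !mulr1. Qed.

(** The upper bound is that of [Fsum_recl], so that the two sums can be subtracted termwise; for
    even [n] this adds one term, which is zero. *)
Lemma Fsum_split1 y n : Fsum x y n.+1 =
  1 + \sum_(0 <= k < n./2.+1)
        (-1) ^+ k.+1 * y ^+ k.+1 * x ^+ 'C(k.+1, 2) * qb x (n - k) k.+1.
Proof.
rewrite (@Fsum_widen y n.+1 n./2.+2) ?big_nat_recl //= ?qb0 ?expr0 ?mulr1 //.
by rewrite uphalf_half; case: odd; lia.
Qed.

Hypothesis x_neq0 : x != 0.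

Lemma Fsum_rec1 y n :
  Fsum x y n.+2 = Fsum x y n.+1 - y * x ^+ n * Fsum x (y / x) n.
Proof.
rewrite Fsum_recl Fsum_split1 -addrA; congr (_ + _).
rewrite /Fsum mulr_sumr -sumrB; apply: eq_big_nat => k /andP[_ kn].
have kn2 : (k + k <= n)%N by lia.
have -> : (n.+1 - k = (n - k).+1)%N by lia.
rewrite qb_pascal1 !exprS binS bin1.
have -> : x ^+ n = x ^+ (n - k - k) * x ^+ k * x ^+ k.
  by rewrite -!exprD; congr (_ ^+ _); lia.
rewrite expr_div_n exprD; have xk : x ^+ k != 0 by rewrite expf_neq0.
by field.
Qed.

Lemma Fsum_rec2 y n :
  Fsum x y n.+2 = Fsum x (y * x) n.+1 - y * Fsum x (y * x) n.
Proof.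
rewrite Fsum_recl Fsum_split1 -addrA; congr (_ + _).
rewrite /Fsum mulr_sumr -sumrB; apply: eq_big_nat => k /andP[_ kn].
have -> : (n.+1 - k = (n - k).+1)%N by lia.
by rewrite qb_pascal2 !exprMn !exprS binS bin1 exprD; ring.
Qed.

Lemma Fsum0 y : Fsum x y 0 = 1.
Proof. by rewrite /Fsum big_nat1 qb0 !expr0 !mulr1. Qed.

Lemma Fsum1 y : Fsum x y 1 = 1.
Proof. by rewrite /Fsum big_nat1 qb0 !expr0 !mulr1. Qed.

Lemma Fsum2 : Fsum x 1 2 = 0.
Proof. by rewrite Fsum_rec1 Fsum1 Fsum0 expr0 !mulr1 subrr. Qed.

(** [Fsum_rec1] at [y = 1] leads to a sum at [y = x^-1], and [Fsum_rec2] leads back from there to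
    [y = 1]. The terms in [F_n] then cancel by the induction hypothesis. *)
Lemma Fsum_add3 n : Fsum x 1 n.+3 = - x ^+ n.+1 * Fsum x 1 n.
Proof.
elim: n => [|n IH].
  by rewrite Fsum_rec1 Fsum2 Fsum0 Fsum1; ring.
rewrite Fsum_rec1 IH mul1r mul1r Fsum_rec2 mulVf // !exprS.
by field.
Qed.

(** The exponent is the pentagonal number [m(3m-1)/2], written without division; in [Fsum_3m1] it is
    [m(3m+1)/2]. *)
Lemma Fsum_3m m : Fsum x 1 (3 * m) = (-1) ^+ m * x ^+ (3 * 'C(m, 2) + m).
Proof.
elim: m => [|m IH]; first by rewrite Fsum0 !mulr1.
have -> : (3 * m.+1 = (3 * m).+3)%N by lia.
rewrite Fsum_add3 IH binS bin1 (exprS (-1)).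
have -> : (3 * ('C(m, 2) + m) + m.+1 = (3 * m).+1 + (3 * 'C(m, 2) + m))%N by lia.
by rewrite (exprD _ (3 * m).+1); ring.
Qed.

Lemma Fsum_3m1 m : Fsum x 1 (3 * m).+1 = (-1) ^+ m * x ^+ (3 * 'C(m, 2) + 2 * m).
Proof.
elim: m => [|m IH]; first by rewrite Fsum1 !mulr1.
have -> : (3 * m.+1 = (3 * m).+3)%N by lia.
rewrite Fsum_add3 IH binS bin1 (exprS (-1)).
have -> : (3 * ('C(m, 2) + m) + 2 * m.+1 = (3 * m).+2 + (3 * 'C(m, 2) + 2 * m))%N by lia.
by rewrite (exprD _ (3 * m).+2); ring.
Qed.

Lemma Fsum_3m2 m : Fsum x 1 (3 * m).+2 = 0.
Proof.
elim: m => [|m IH]; first exact: Fsum2.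
have -> : (3 * m.+1 = (3 * m).+3)%N by lia.
by rewrite Fsum_add3 IH mulr0.
Qed.

(** Put [N = n+2], [j = k+1] and split [1 - x^N = (1 - x^(N-j)) + x^(N-j) (1 - x^j)]. The first part
    gives a term of [F_N]; by [qb_absorb] the second gives a term of [F_n]. *)
Lemma sum_theta n : 
  \sum_(0 <= k < n./2.+1) (-1) ^+ k.+1 * x ^+ 'C(k.+1, 2)
     * ((1 - x ^+ n.+2) / (1 - x ^+ (n.+1 - k)) * qb x (n.+1 - k) k.+1)
  = Fsum x 1 n.+2 - x ^+ n.+1 * Fsum x 1 n - 1.
Proof.
rewrite Fsum_recl [RHS]addrAC [X in _ = X - _ - _]addrC addrK /Fsum mulr_sumr -sumrB.
apply: eq_big_nat => k /andP[_ kn].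
have nk : (n.+1 - k = (n - k).+1)%N by lia.
have -> : x ^+ n.+2 = x ^+ (n.+1 - k) * x ^+ k.+1.
  by rewrite -!exprD; congr (_ ^+ _); lia.
have -> : x ^+ n.+1 = x ^+ (n.+1 - k) * x ^+ k.
  by rewrite -!exprD; congr (_ ^+ _); lia.
rewrite nk; have := qb_absorb (n - k) k; have := x_not1 (ltn0Sn (n - k)).
set u := x ^+ (n - k).+1; set A := qb _ _.+1 _; set B := qb _ _ _ => u1 AB.
have -> : B = A * (1 - x ^+ k.+1) / (1 - u) by rewrite AB; field.
by rewrite !exprS binS bin1 exprD !expr1n; field.
Qed.

(** Same method with the split [1 - x^N = x^j (1 - x^(N-j)) + (1 - x^j)], whose first part absorbs
    the weight [x^-j]. *)
Lemma sum_vartheta n : 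
  \sum_(0 <= k < n./2.+1) (-1) ^+ k.+1 * (x ^+ 'C(k.+1, 2) / x ^+ k.+1)
     * ((1 - x ^+ n.+2) / (1 - x ^+ (n.+1 - k)) * qb x (n.+1 - k) k.+1)
  = Fsum x 1 n.+2 - x^-1 * Fsum x 1 n - 1.
Proof.
rewrite Fsum_recl [RHS]addrAC [X in _ = X - _ - _]addrC addrK /Fsum mulr_sumr -sumrB.
apply: eq_big_nat => k /andP[_ kn].
have nk : (n.+1 - k = (n - k).+1)%N by lia.
have -> : x ^+ n.+2 = x ^+ (n.+1 - k) * x ^+ k.+1.
  by rewrite -!exprD; congr (_ ^+ _); lia.
rewrite nk; have := qb_absorb (n - k) k; have := x_not1 (ltn0Sn (n - k)).
set u := x ^+ (n - k).+1; set A := qb _ _.+1 _; set B := qb _ _ _ => u1 AB.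
have -> : B = A * (1 - x ^+ k.+1) / (1 - u) by rewrite AB; field.
have xk : x ^+ k != 0 by rewrite expf_neq0.
rewrite !exprS binS bin1 exprD !expr1n; field.
by repeat (apply/andP; split).
Qed.

End GaussianBinomials.

(** * Rising factorials at a root of unity *)

(** This is [qfac x (m + d) / qfac x m], kept as a product so that it stays meaningful at a root of
    unity, where both factorials may vanish. *)
Definition rfac (F : fieldType) (x : F) m d : F :=
  \prod_(0 <= i < d) (1 - x ^+ (m + i).+1).

Section RisingFactorials.

Variables (F : fieldType) (x : F).

Lemma rfacS m d : rfac x m d.+1 = rfac x m d * (1 - x ^+ (m + d).+1).
Proof. by rewrite /rfac big_nat_recr. Qed.

Lemma rfac_recl m d : rfac x m d.+1 = (1 - x ^+ m.+1) * rfac x m.+1 d.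
Proof.
rewrite /rfac big_nat_recl //= addn0; congr (_ * _).
by apply: eq_bigr => i _; rewrite addSnnS.
Qed.

Lemma rfac0 d : rfac x 0 d = qfac x d.
Proof. by rewrite /rfac /qfac big_add1 /=; apply: eq_bigr. Qed.

Lemma qfacD m d : qfac x (m + d) = qfac x m * rfac x m d.
Proof.
elim: d => [|d IH]; first by rewrite addn0 /rfac big_geq // mulr1.
by rewrite addnS qfacS IH rfacS mulrA.
Qed.

Lemma rfac_neq0 m d :
  (forall i, (m < i <= m + d)%N -> 1 - x ^+ i != 0) -> rfac x m d != 0.
Proof.
elim: d => [|d IH] h; first by rewrite /rfac big_geq // oner_eq0.
rewrite rfacS mulf_neq0 //; first by apply: IH => i hi; apply: h; lia.
by apply: h; lia.
Qed.

Variable n : nat.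
Hypothesis xn : x ^+ n = 1.

Lemma expr_addn_period t i : x ^+ (t * n + i) = x ^+ i.
Proof. by rewrite exprD mulnC exprM xn expr1n mul1r. Qed.

Lemma rfac_period t m d : rfac x (t * n + m) d = rfac x m d.
Proof.
by apply: eq_bigr => i _; rewrite -addnA -addnS expr_addn_period.
Qed.

(** Factor by factor, [x^n = 1] gives [(1 - x^(n-i)) x^i = -(1 - x^i)], for [i] from [t+1] to
    [t+d]. *)
Lemma rfac_reflect t d : (t + d < n)%N ->
  rfac x (n - (t + d).+1) d * x ^+ (t.+1 * d + 'C(d, 2)) = (-1) ^+ d * rfac x t d.
Proof.
elim: d => [|d IH] tdn; first by rewrite /rfac !big_geq // muln0 !mulr1.
rewrite rfac_recl (_ : (n - (t + d.+1).+1).+1 = n - (t + d).+1)%N; last by lia.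
rewrite binS bin1.
have -> : (t.+1 * d.+1 + ('C(d, 2) + d) = (t + d).+1 + (t.+1 * d + 'C(d, 2)))%N by lia.
rewrite exprD mulrACA IH; last by lia.
rewrite mulrBl mul1r -exprD subnK ?xn; last by lia.
by rewrite (exprS (-1)) rfacS; ring.
Qed.

(* Up to sign, the two sides are U_j and V_j of the header at j = k+1 and q = x. *)
Lemma summand_at_root k : (k.+1.*2 <= n)%N -> x != 0 ->
  (forall i, (0 < i < n)%N -> 1 - x ^+ i != 0) ->
  x ^- 'C(k.+2, 2) * rfac x (n - k.+1) k * rfac x k.+1 k.+1
    / (qfac x k.+1 * qfac x k.+1)
  = x ^+ 'C(k.+1, 2) * (1 + x ^- k.+1) * rfac x (n - k.+1.*2) k / qfac x k.+1.
Proof.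
move=> kn x0 x1.
have r0 : qfac x k != 0 by rewrite -rfac0 rfac_neq0 // => i hi; apply: x1; lia.
have k1 : 1 - x ^+ k.+1 != 0 by apply: x1; lia.
(* Reflection at [t = 0] turns [rfac x (n - k.+1) k] into [qfac x k]; at [t = k+1] it turns
   [rfac x (n - k.+1.*2) k] into [rfac x k.+1 k]. *)
have /= E1 := @rfac_reflect 0 k _; have /= E2 := @rfac_reflect k.+1 k _.
move: E1 E2; rewrite add0n (_ : (k.+1 + k).+1 = k.+1.*2)%N; last by lia.
move=> E1 E2; move: {E1 E2} (E1 ltac:(lia)) (E2 ltac:(lia)).
rewrite rfac0 mul1n => E1 E2.
have xk p : x ^+ p != 0 by rewrite expf_neq0.
have /(canRL (mulfK (xk _))) -> := E1.
have /(canRL (mulfK (xk _))) -> := E2.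
(* The last factor [1 - x^(2k+2)] is [(1 - x^(k+1)) (1 + x^(k+1))], the source of [1 + x^-(k+1)];
   apart from it only powers of [x] have to be compared. *)
rewrite qfacS rfacS -addnS addnn -muln2 exprM.
(* Replacing [k * k] makes every power of [x] a monomial in [x], [x^k] and [x^C(k,2)]. *)
have C2 : ('C(k, 2) + 'C(k, 2) + k = k * k)%N.
  by elim: (k) => // p; rewrite binS bin1; lia.
have -> : x ^+ (k.+2 * k + 'C(k, 2))
   = x ^+ 'C(k, 2) * x ^+ 'C(k, 2) * x ^+ 'C(k, 2) * x ^+ k * x ^+ k * x ^+ k.
  by rewrite -!exprD; congr (_ ^+ _); lia.
rewrite !binS !bin1 !bin0 !(exprD, exprS) expr0 in k1 *.
have := (xk k, xk 'C(k, 2)); move: k1 r0 x0.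
move: (x ^+ k) (x ^+ 'C(k, 2)) => A B.
move=> ? ? ? [? ?]; field; repeat (apply/andP; split => //).
Qed.

End RisingFactorials.

(** * Specialisation to [q]: [theta_n] and [vartheta_n] as alternating sums *)

Lemma q_neq0 : q != 0.
Proof. by rewrite tofrac_eq0 polyX_eq0. Qed.

Lemma q_not1 i : (0 < i)%N -> 1 - q ^+ i != 0.
Proof.
move=> i0; rewrite -tofracXn -tofrac1 -tofracB tofrac_eq0 -oppr_eq0 opprB.
by rewrite -size_poly_eq0 size_XnsubC.
Qed.

Lemma qbinomE (n m : nat) : qbinom n%:Z m%:Z = qb q n m.
Proof.
rewrite /qbinom /qb /= lez_nat; case: leqP => // mn.
have -> : \prod_(1 <= i < m.+1) (1 - q ^ i%:Z) = qfac q m by exact: eq_bigr.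
suff -> : \prod_(0 <= i < m) (1 - q ^ (n%:Z - i%:Z)) = qfac q n / qfac q (n - m).
  by rewrite invfM mulrA mulrAC.
elim: m mn => [|m IH] mn.
  by rewrite big_geq // subn0 divff ?qfac_neq0 //; exact: q_not1.
rewrite big_nat_recr //= IH; last exact: ltnW.
rewrite -(subnSK mn) qfacS -/(subn n m.+1).
have -> : (n%:Z - m%:Z)%R = (n - m.+1).+1%:Z by lia.
have /= := (qfac_neq0 q_not1 (n - m.+1), q_not1 (ltn0Sn (n - m.+1))).
rewrite -exprnP; move: (qfac q n) (qfac q (n - m.+1)) (1 - q ^+ (n - m.+1).+1).
by move=> A B C [B0 C0]; rewrite invfM -!mulrA mulVf // mulr1.
Qed.

Lemma mul2_bin2 m : 2 * 'C(m, 2)%:Z = m%:Z * (m%:Z - 1).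
Proof. by elim: m => // m IH; rewrite binS bin1; lia. Qed.

Lemma divz2_eq (i j : int) : i = j * 2 -> (i %/ 2)%Z = j.
Proof. by move=> ->; rewrite mulzK. Qed.

Lemma theta1 : theta 1 = 1. Proof. by rewrite /theta /= mulr1. Qed.
Lemma vartheta1 : vartheta 1 = 1. Proof. by rewrite /vartheta /= mulr1. Qed.

(** [F_i] vanishes for [i = 2] modulo 3, so one term drops out unless [n.+2 = 3m]; in that case both
    survive and produce the factor [1 + q^m]. *)
Lemma theta_Fsum n : theta n.+2 = Fsum q 1 n.+2 - q ^+ n.+1 * Fsum q 1 n.
Proof.
have q0 := q_neq0; have q1 := q_not1.
have := divn_eq n.+2 3; have := ltn_pmod n.+2 (isT : 0 < 3)%N.
rewrite /theta; set m := (n.+2 %/ 3)%N; have := mul2_bin2 m.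
case: (n.+2 %% 3)%N => [|[|[|//]]] /= Cm _ nE.
- have [p mE] : exists p, m = p.+1 by exists m.-1; lia.
  rewrite {}mE in Cm nE *; rewrite nE addn0 mulnC.
  have [-> ->] : (n.+1 = (3 * p).+2)%N /\ n = (3 * p).+1 by lia.
  rewrite Fsum_3m // Fsum_3m1 // (@divz2_eq _ (3 * 'C(p.+1, 2) + p.+1)%N%:Z); last by lia.
  rewrite -!exprnP binS bin1 mulnDr.
  have -> : (3 * 'C(p, 2) + 3 * p + p.+1 = (3 * 'C(p, 2) + 2 * p) + (2 * p).+1)%N by lia.
  have -> : (3 * p).+2 = ((2 * p).+1 + p.+1)%N by lia.
  rewrite !(exprD q) exprS; ring.
- have [p mE] : exists p, m = p.+1 by exists m.-1; lia.
  have -> : n = (3 * p).+2 by lia.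
  rewrite Fsum_3m2 // mulr0 subr0 (_ : (3 * p).+4 = (3 * m).+1); last by lia.
  by rewrite Fsum_3m1 // (@divz2_eq _ (3 * 'C(m, 2) + 2 * m)%N%:Z) //; lia.
- have -> : n = (3 * m)%N by lia.
  rewrite Fsum_3m2 // Fsum_3m // sub0r.
  rewrite (@divz2_eq _ ((3 * m).+1 + (3 * 'C(m, 2) + m))%N%:Z); last by lia.
  rewrite -exprnP (exprD _ (3 * m).+1) (exprS (-1)); ring.
Qed.

Lemma vartheta_Fsum n : vartheta n.+2 = Fsum q 1 n.+2 - q^-1 * Fsum q 1 n.
Proof.
have q0 := q_neq0; have q1 := q_not1.
have := divn_eq n.+2 3; have := ltn_pmod n.+2 (isT : 0 < 3)%N.
rewrite /vartheta; set m := (n.+2 %/ 3)%N; have := mul2_bin2 m.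
case: (n.+2 %% 3)%N => [|[|[|//]]] /= Cm _ nE.
- have [p mE] : exists p, m = p.+1 by exists m.-1; lia.
  rewrite {}mE in Cm nE *; rewrite nE addn0 mulnC.
  have -> : n = (3 * p).+1 by lia.
  rewrite Fsum_3m // Fsum_3m1 //.
  (* With [m = p+1], the exponent [m(3m-5)/2] equals [p(3p+1)/2 - 1], and the [-1] matches the
     coefficient [q^-1] of [F_n]. *)
  rewrite (@divz2_eq _ (-1 + (3 * 'C(p, 2) + 2 * p)%N%:Z)); last first.
    by move: Cm; rewrite binS bin1; lia.
  rewrite (_ : 2 * p.+1%:Z = (2 * p).+2%:Z); last by lia.
  rewrite expfzDr // exprN1 -!exprnP.
  have -> : (3 * 'C(p.+1, 2) + p.+1 = (3 * 'C(p, 2) + 2 * p) + (2 * p).+1)%N.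
    by rewrite binS bin1; lia.
  rewrite (exprS _ (2 * p).+1) (exprD _ _ (2 * p).+1) (exprS (-1)).
  have aux (F : fieldType) (x s a b : F) : x != 0 ->
      -1 * s * (1 + x * b) * (x^-1 * a) = -1 * s * (a * b) - x^-1 * (s * a).
    by move=> ?; field.
  exact: aux.
- have [p mE] : exists p, m = p.+1 by exists m.-1; lia.
  have -> : n = (3 * p).+2 by lia.
  rewrite Fsum_3m2 // mulr0 subr0 (_ : (3 * p).+4 = (3 * m).+1); last by lia.
  by rewrite Fsum_3m1 // (@divz2_eq _ (3 * 'C(m, 2) + 2 * m)%N%:Z) //; lia.
- have -> : n = (3 * m)%N by lia.
  rewrite Fsum_3m2 // Fsum_3m // sub0r.
  rewrite (@divz2_eq _ (-1 + (3 * 'C(m, 2) + m)%N%:Z)); last by lia.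
  rewrite expfzDr // exprN1 -exprnP (exprS (-1)); ring.
Qed.

(** [sum_theta] and [sum_vartheta] are added; each contributes one unit of the constant 2. The case
    [n = 1] lies outside [theta_Fsum], and there both sides are zero. *)
Lemma theta_vartheta_sum n : (0 < n)%N ->
  2 - theta n - vartheta n =
  - \sum_(0 <= k < n./2) (-1) ^+ k.+1 * (q ^+ 'C(k.+1, 2) * (1 + q ^- k.+1))
     * ((1 - q ^+ n) / (1 - q ^+ (n - k.+1)) * qb q (n - k.+1) k.+1).
Proof.
have q0 := q_neq0; have q1 := q_not1.
case: n => [//|[|n]] _; first by rewrite theta1 vartheta1 big_geq //; ring.
have := congr2 +%R (sum_theta q1 q0 n) (sum_vartheta q1 q0 n).
rewrite -theta_Fsum -vartheta_Fsum -big_split /= => E.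
rewrite (_ : 2 - _ - _ = - (theta n.+2 - 1 + (vartheta n.+2 - 1))); last by ring.
rewrite -E; congr (- _); apply: eq_bigr => k _.
by rewrite subSS -mulrDl -mulrDr [_ * (1 + _)]mulrDr mulr1.
Qed.

(** * The summands of [tau0'] relative to the main term, and their values at [z] *)

Lemma qb_rfac (F : fieldType) (x : F) d j :
  (forall i, (0 < i)%N -> 1 - x ^+ i != 0) ->
  qb x (d + j) j = rfac x d j / qfac x j.
Proof.
move=> x1; rewrite {1}addnC qbE addnC qfacD.
by have := (qfac_neq0 x1 d, qfac_neq0 x1 j) => -[? ?]; field; apply/andP.
Qed.

(** The factor [1 - x ^+ (L + k.+1)] is kept apart because it becomes the [1 - q^K] that is
    divisible by ['Phi_n]. *)
Lemma qb_shift (F : fieldType) (x : F) L M k :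
  (forall i, (0 < i)%N -> 1 - x ^+ i != 0) ->
  qb x (L + k.+1 + M) L = qb x (L + k.+1 + M) (L + k.+1)
    * ((1 - x ^+ (L + k.+1)) * (rfac x L k / rfac x M k.+1)).
Proof.
move=> x1; rewrite qbE -{1}addnA qbE (addnC k.+1 M) addnA addnAC.
rewrite !qfacD !rfacS -addnS.
have h := (qfac_neq0 x1 L, qfac_neq0 x1 M).
have r m d : rfac x m d != 0 by rewrite rfac_neq0 // => i hi; apply: x1; lia.
have := (h, r L k, r M k, x1 (L + k.+1)%N ltac:(lia), x1 (M + k).+1 ltac:(lia)).
by move=> [[[[[? ?] ?] ?] ?] ?]; field; repeat (apply/andP; split).
Qed.

(** For [N = an], [M = bn], [K = an - bn], the summation index is [L = K - j] with [j = k+1]; the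
    factor after [1 - q ^+ K] is the [U_j] of the header. *)
Lemma tau0'_summand L M k (N := (L + k.+1 + M)%N) (K := (L + k.+1)%N) :
  (-1) ^+ L * q ^ ((N * L)%:Z - 'C(L, 2)%:Z) * qb q N L
    * qb q (2 * M + k.+1 + k.+1) k.+1
  = (-1) ^+ K * q ^ ((N * K)%:Z - 'C(K, 2)%:Z) * qb q N K
    * ((1 - q ^+ K) * ((-1) ^+ k.+1 * q ^ (- (M * k.+1 + 'C(k.+2, 2))%:Z)
       * (rfac q L k / rfac q M k.+1
          * (rfac q (2 * M + k.+1) k.+1 / qfac q k.+1)))).
Proof.
have q1 := q_not1; rewrite qb_rfac // qb_shift // -/N -/K.
have -> : (N * L)%:Z - 'C(L, 2)%:Z =
    (N * K)%:Z - 'C(K, 2)%:Z - (M * k.+1 + 'C(k.+2, 2))%:Z.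
  by move: (mul2_bin2 L) (mul2_bin2 K) (mul2_bin2 k.+2); rewrite /N /K; nia.
rewrite expfzDr ?q_neq0 //.
have -> : (-1) ^+ L = (-1) ^+ K * (-1) ^+ k.+1 :> Zq.
  by rewrite /K exprD -mulrA -expr2 sqrr_sign mulr1.
ring.
Qed.

(** The defining quotient can be 0/0 at [z], but Pascal's rule shows by induction that a value
    exists. *)
Lemma ev_qb z n m : exists c, ev z (qb q n m) c.
Proof.
have q1 := q_not1.
elim: n m => [|n IH] [|m].
- by exists 1; rewrite qb0 //; exact: ev1.
- by exists 0; rewrite qb_small //; exact: (ev_int z 0).
- by exists 1; rewrite qb0 //; exact: ev1.
- have [c1 h1] := IH m.+1; have [c2 h2] := IH m.
  exists (c1 + z ^+ (n - m) * c2); rewrite qb_pascal1 //.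
  by apply: ev_add => //; apply: ev_mul => //; exact/ev_exp/ev_q.
Qed.

Lemma ev_sign z k : ev z ((-1) ^+ k) ((-1) ^+ k).
Proof. by apply: ev_exp; exact: (ev_int z (-1)). Qed.

Lemma ev_rfac z m d : ev z (rfac q m d) (rfac z m d).
Proof.
by apply: ev_prod => i _; apply: ev_sub; [exact: ev1 | exact/ev_exp/ev_q].
Qed.

Lemma ev_qfac z d : ev z (qfac q d) (qfac z d).
Proof. by rewrite -!rfac0; exact: ev_rfac. Qed.

Lemma prim_root_neq0 (z : algC) n : n.-primitive_root z -> z != 0.
Proof.
move=> zP; apply: contra_eq_neq (prim_expr_order zP) => ->.
by rewrite expr0n gtn_eqF ?(prim_order_gt0 zP) // eq_sym oner_neq0.
Qed.

(** The geometric sum is [(1 - q^(cn)) / (1 - q^n)] and takes the value [c] at [z], where [U_j] and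
    [V_j] coincide. This vanishing yields the second factor ['Phi_n]. *)
Lemma summand_congr z n M c k :
  n.-primitive_root z -> (0 < c)%N -> (k.+1.*2 <= n)%N ->
  ev z ((\sum_(0 <= t < c) q ^+ n ^+ t)
         * ((-1) ^+ k.+1 * q ^ (- (M * n * k.+1 + 'C(k.+2, 2))%:Z)
            * (rfac q (c * n - k.+1) k / rfac q (M * n) k.+1
               * (rfac q (2 * (M * n) + k.+1) k.+1 / qfac q k.+1)))
        - c%:R * ((-1) ^+ k.+1 * (q ^+ 'C(k.+1, 2) * (1 + q ^- k.+1))
            * (rfac q (n - k.+1.*2) k / qfac q k.+1))) 0.
Proof.
move=> zP c0 kn; have z0 := prim_root_neq0 zP.
have zn := prim_expr_order zP.
have z1 i : (0 < i < n)%N -> 1 - z ^+ i != 0.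
  move=> /andP[i0 lin]; rewrite subr_eq0 eq_sym -(prim_order_dvd zP).
  by rewrite gtnNdvd.
have f0 : qfac z k.+1 != 0.
  by rewrite -rfac0 rfac_neq0 // => i hi; apply: z1; lia.
(* Multiples of [n] drop out by periodicity, which reduces the claim to [summand_at_root]; the
   common sign is left aside. *)
have uv : z ^ (- (M * n * k.+1 + 'C(k.+2, 2))%:Z)
            * (rfac z (c * n - k.+1) k / rfac z (M * n) k.+1
               * (rfac z (2 * (M * n) + k.+1) k.+1 / qfac z k.+1))
        = z ^+ 'C(k.+1, 2) * (1 + z ^- k.+1)
            * (rfac z (n - k.+1.*2) k / qfac z k.+1).
  rewrite (_ : c * n - k.+1 = c.-1 * n + (n - k.+1))%N; last by nia.
  rewrite -{2}[(M * n)%N]addn0 [(2 * _)%N]mulnA !rfac_period // rfac0.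
  rewrite -exprnN mulnAC expr_addn_period //.
  rewrite [RHS]mulrA -(summand_at_root zn kn z0 z1).
  rewrite invfM -!mulrA; congr (_ * (_ * _)).
  by rewrite mulrCA.
(* Zero is written as the difference of the two values so that the rules for [ev] apply along the
   shape of the expression. *)
rewrite (_ : 0 = c%:R * ((-1) ^+ k.+1 * (z ^ (- (M * n * k.+1 + 'C(k.+2, 2))%:Z)
            * (rfac z (c * n - k.+1) k / rfac z (M * n) k.+1
               * (rfac z (2 * (M * n) + k.+1) k.+1 / qfac z k.+1))))
        - c%:R * ((-1) ^+ k.+1 * (z ^+ 'C(k.+1, 2) * (1 + z ^- k.+1)
            * (rfac z (n - k.+1.*2) k / qfac z k.+1)))); last by rewrite uv subrr.
rewrite -!(mulrA ((-1) ^+ k.+1)).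
have evz := ev_q z.
have evc : ev z c%:R c%:R by exact: (ev_int z c).
have evp i : ev z (q ^+ i) (z ^+ i) by exact: ev_exp.
have r0 : rfac z (M * n) k.+1 != 0.
  by rewrite -[(M * n)%N]addn0 rfac_period // rfac0.
have evV i j : (qfac z j != 0) -> ev z (rfac q i k / qfac q j) (rfac z i k / qfac z j).
  by move=> ?; apply: ev_mul (ev_rfac _ _ _) (ev_inv (ev_qfac _ _) _).
apply: ev_sub; apply: ev_mul.
- have -> : c%:R = \sum_(0 <= t < c) z ^+ n ^+ t :> algC.
    rewrite (eq_bigr (fun=> 1)) => [|t _]; last by rewrite zn expr1n.
    by rewrite sumr_const_nat subn0.
  by apply: ev_sum => t _; apply: ev_exp.
- apply: ev_mul (ev_sign _ _) _; apply: ev_mul; first exact: ev_expz.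
  apply: ev_mul; last exact: ev_mul (ev_rfac _ _ _) (ev_inv (ev_qfac _ _) f0).
  exact: ev_mul (ev_rfac _ _ _) (ev_inv (ev_rfac _ _ _) r0).
- exact: evc.
- apply: ev_mul (ev_sign _ _) _; apply: ev_mul; last exact: evV.
  apply: ev_mul => //; apply: ev_add (ev1 _) _.
  by apply: ev_inv => //; rewrite expf_neq0.
Qed.

Theorem theorem1p3 (a b n : nat)
    (ha : (0 < a)%N) (hb : (0 < b)%N) (hn : (0 < n)%N) (hab : (b < a)%N) :
  eqmod_Phi2 n (tau0' a b n)
    ((-1) ^+ (a * n - b * n)%N
       * q ^ (((a * n)%:Z - (b * n)%:Z) * ((a * n)%:Z + (b * n)%:Z + 1) %/ 2)%Z
       * qbinom (a * n)%:Z (b * n)%:Z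
       * (1 - (a%:R - b%:R) * (2 - theta n - vartheta n))).
Proof.
have q1 := q_not1; have [z zP] := C_prim_root_exists hn.
have [c aE] : exists c, a = (c + b)%N by exists (a - b)%N; lia.
have c0 : (0 < c)%N by lia.
pose N := (a * n)%N; pose M := (b * n)%N; pose K := (c * n)%N.
have NE : N = (K + M)%N by rewrite /N aE mulnDl.
have nK : (n <= K)%N by rewrite leq_pmull.
rewrite -/N -/M (_ : N - M = K)%N; last by rewrite NE addnK.
(* Since [N + M + 1 = 2N - (K - 1)], the stated exponent is that of the summand of index [K]. *)
rewrite (@divz2_eq _ ((N * K)%:Z - 'C(K, 2)%:Z)); last first.
  by move: (mul2_bin2 K); rewrite NE; nia.
rewrite qbinomE.
have -> : qb q N M = qb q N K by rewrite NE qbE addnC qbE mulrC [qfac _ M * _]mulrC mulrC.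
set main := (-1) ^+ K * q ^ _ * _.
pose U k : Zq := (-1) ^+ k.+1 * q ^ (- (M * k.+1 + 'C(k.+2, 2))%:Z)
  * (rfac q (K - k.+1) k / rfac q M k.+1
     * (rfac q (2 * M + k.+1) k.+1 / qfac q k.+1)).
(* This is [V_j] for [j = k+1], with [1 - q^(n-j)] cancelled against the top factor of
   [[n-j, j]]. *)
pose V k : Zq := (-1) ^+ k.+1 * (q ^+ 'C(k.+1, 2) * (1 + q ^- k.+1))
  * (rfac q (n - k.+1.*2) k / qfac q k.+1).
have tauE : tau0' a b n = main * (1 + (1 - q ^+ K) * \sum_(0 <= k < n./2) U k).
  rewrite /tau0' -/N -/M (_ : N - M = K)%N; last by rewrite NE addnK.
  have nK2 : (K - n./2 <= K.+1)%N by lia.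
  (* Reversing and shifting the range turns the index into [K - k]; the term [k = 0] is the main
     term. *)
  rewrite big_nat_rev -{1}[(K - n./2)%N]add0n big_addn.
  rewrite (_ : K.+1 - (K - n./2) = n./2.+1)%N; last by lia.
  rewrite big_nat_recl // mulrDr mulr1 !mulr_sumr.
  rewrite (_ : K - n./2 + K.+1 - (0 + (K - n./2)).+1 = K)%N; last by lia.
  congr (_ + _).
    rewrite !qbinomE (_ : N%:Z - M%:Z - K%:Z = 0%:Z); last by lia.
    rewrite (_ : (2 * a * n)%:Z - (2 * K)%:Z = (2 * M)%:Z); last by lia.
    by rewrite qbinomE qb0 // mulr1.
  apply: eq_big_nat => k /andP[_ kn].
  rewrite (_ : K - n./2 + K.+1 - (k.+1 + (K - n./2)).+1 = K - k.+1)%N; last by lia.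
  rewrite (_ : N%:Z - M%:Z - (K - k.+1)%N%:Z = k.+1%:Z); last by lia.
  rewrite (_ : (2 * a * n)%:Z - (2 * (K - k.+1))%N%:Z
    = (2 * M + k.+1 + k.+1)%N%:Z); last by lia.
  rewrite !qbinomE /main /U.
  have KE : K = (K - k.+1 + k.+1)%N by lia.
  have := tau0'_summand (K - k.+1) M k.
  by rewrite -KE -NE.
have thetaE : 2 - theta n - vartheta n = - ((1 - q ^+ n) * \sum_(0 <= k < n./2) V k).
  rewrite theta_vartheta_sum // mulr_sumr; congr (- _).
  apply: eq_big_nat => k /andP[_ kn]; rewrite /V.
  rewrite [RHS]mulrCA; congr (_ * _).
  rewrite {2}(_ : n - k.+1 = n - k.+1.*2 + k.+1)%N; last by lia.
  rewrite qb_rfac // rfacS (_ : (n - k.+1.*2 + k).+1 = n - k.+1)%N; last by lia.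
  have h : 1 - q ^+ (n - k.+1) != 0 by apply: q1; lia.
  move: h; move: (1 - q ^+ n) (1 - q ^+ (n - _)) (rfac _ _ _) (qfac _ _)^-1.
  by move=> A B C D B0; rewrite mulrA [C * B]mulrC mulrA mulrA divfK.
have KE : 1 - q ^+ K = (1 - q ^+ n) * \sum_(0 <= t < c) q ^+ n ^+ t.
  by rewrite /K mulnC exprM -[LHS]opprB subrX1 -mulNr opprB big_mkord.
have [d hd] : exists d, ev z main d.
  have [e he] := ev_qb z N K; exists ((-1) ^+ K * z ^ ((N * K)%:Z - 'C(K, 2)%:Z) * e).
  apply: ev_mul he; apply: ev_mul; first exact: ev_sign.
  apply: ev_expz; first exact: ev_q.
  exact: prim_root_neq0 zP.
(* The main terms cancel, and [1 - q^n] splits off from both [1 - q^K] and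
   [2 - theta n - vartheta n]. What remains is [main], which is defined at [z], times a sum that
   vanishes there. *)
apply: (@eqmod_Phi2_ev n z _ _
  (\sum_(0 <= k < n./2) ((\sum_(0 <= t < c) q ^+ n ^+ t) * U k - c%:R * V k))
  main 0 zP); last by exists d.
  rewrite tauE thetaE KE sumrB -!mulr_sumr.
  rewrite (_ : a%:R - b%:R = c%:R); last by rewrite aE natrD addrK.
  ring.
rewrite (_ : 0 = \sum_(0 <= k < n./2) 0 :> algC); last by rewrite big1.
apply: ev_sum => k /andP[_ kn].
by apply: summand_congr => //; lia.
Qed.
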